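(* Any one-sided (possibly adaptive) tester for $k$-monotonicity of functions $f\colon[n]\to\{0,1\}$ with distance parameter $\varepsilon$ must have query complexity $\Omega(k/\varepsilon)$.
   Context: $[n]=\{1,\dots,n\}$ with its usual total order. A function $f\colon[n]\to\{0,1\}$ is $k$-monotone if there do not exist $x_1\leq x_2\leq\cdots\leq x_{k+1}$ with $f(x_1)=1$ and $f(x_i)\neq f(x_{i+1})$ for all $i\in[k]$. Distance is normalized Hamming distance; $f$ is $\varepsilon$-far from $k$-monotone if $\Pr_x[f(x)\neq g(x)]\geq\varepsilon$ for every $k$-monotone $g$. A tester, given $\varepsilon$ and query access to $f$, accepts $k$-monotone $f$ with probability at least $2/3$ and rejects $\varepsilon$-far $f$ with probability at least $2/3$; one-sided means $k$-monotone functions are accepted with probability $1$. Adaptive testers may choose queries depending on previous answers. *)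

(* Defs.v *)
From mathcomp Require Import all_boot all_order all_algebra.
From mathcomp Require Import reals.
Set Implicit Arguments. Unset Strict Implicit. Unset Printing Implicit Defensive.
Import Order.TTheory GRing.Theory Num.Theory.
Local Open Scope ring_scope.

(* The domain [n] = {1,..,n} is represented by 'I_n = {0,..,n-1} with the
   order inherited from nat (an order isomorphism). *)

Definition kmonotone (n k : nat) (f : 'I_n -> bool) : Prop :=
  ~ exists x : 'I_k.+1 -> 'I_n,
      [/\ forall i : 'I_k, (x (widen_ord (leqnSn k) i) <= x (lift ord0 i))%N,
          f (x ord0) = true
        & forall i : 'I_k, f (x (widen_ord (leqnSn k) i)) != f (x (lift ord0 i))].

Definition dist (R : realType) (n : nat) (f g : 'I_n -> bool) : R :=
  #|[set x | f x != g x]|%:R / n%:R.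

Definition far (R : realType) (n k : nat) (eps : R) (f : 'I_n -> bool) : Prop :=
  forall g : 'I_n -> bool, kmonotone k g -> eps <= dist R f g.

(* Deterministic adaptive query algorithms: decision trees. A node queries
   f at a point and continues in the subtree selected by the answer; a leaf
   outputs accept (true) / reject (false). *)
Inductive dtree (n : nat) : Type :=
| Leaf of bool
| Node of 'I_n & dtree n & dtree n.   (* Node x t_if_0 t_if_1 *)

Fixpoint run (n : nat) (t : dtree n) (f : 'I_n -> bool) : bool :=
  match t with
  | Leaf b => b
  | Node x t0 t1 => if f x then run t1 f else run t0 f
  end.

Fixpoint depth (n : nat) (t : dtree n) : nat :=
  match t with
  | Leaf _ => 0
  | Node _ t0 t1 => (maxn (depth t0) (depth t1)).+1
  end.

(* A randomized (possibly adaptive) algorithm: a probability distribution p on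
   a finite sample space Omega of random seeds, each seed fixing a
   deterministic decision tree T w. *)
Definition is_distr (R : realType) (Omega : finType) (p : Omega -> R) : Prop :=
  (forall w, 0 <= p w) /\ \sum_(w : Omega) p w = 1.

Definition acc_prob (R : realType) (n : nat) (Omega : finType)
  (p : Omega -> R) (T : Omega -> dtree n) (f : 'I_n -> bool) : R :=
  \sum_(w : Omega) p w * (run (T w) f)%:R.

Definition one_sided_tester (R : realType) (n k : nat) (eps : R) (q : nat)
  (Omega : finType) (p : Omega -> R) (T : Omega -> dtree n) : Prop :=
  [/\ is_distr p,
      (forall w, 0 < p w -> (depth (T w) <= q)%N),
      (forall f, kmonotone k f -> acc_prob p T f = 1)
    & (forall f, far k eps f -> acc_prob p T f <= 1 / 3)].

(* Main.v *)
(** Cut [n] into 4k groups of m+2 blocks of width s, with m + 2 about 1/(8 eps).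
    A random function lights each group with probability 1/2 and, in a lit
    group, sets to 1 one uniformly random block among the first m+1.  If at
    least 2k groups are lit, which holds for a code or for its complement, the
    function is far from k-monotone.  A one-sided tester can only reject after
    querying lit blocks in more than k/2 groups: turning off the other groups
    gives a k-monotone function with the same answers.  Whether a block is
    queried does not depend on the values inside that block, so a group's lit
    block is found with probability at most 1/(m+1) times the expected number
    of blocks queried in that group, even adaptively.  Hence q queries find at
    most q/(m+1) lit blocks on average, which forces k (m + 1) <= 6 q. *)
Require Import Defs.
From mathcomp Require Import all_boot all_order all_algebra.
From mathcomp Require Import reals.
From mathcomp Require Import zify ring lra.
Set Implicit Arguments. Unset Strict Implicit. Unset Printing Implicit Defensive.
Import Order.TTheory GRing.Theory Num.Theory.
Local Open Scope ring_scope.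

(** * Points queried by a decision tree *)

Fixpoint queries (n : nat) (t : dtree n) (f : 'I_n -> bool) : seq 'I_n :=
  match t with
  | Leaf _ => [::]
  | Node x t0 t1 => x :: (if f x then queries t1 f else queries t0 f)
  end.

Lemma size_queries n (t : dtree n) f : (size (queries t f) <= depth t)%N.
Proof.
elim: t => //= x t0 IH0 t1 IH1; rewrite ltnS leq_max.
by case: (f x); rewrite ?IH0 ?IH1 ?orbT.
Qed.

Lemma eq_run_queries n (t : dtree n) f g :
  {in queries t f, f =1 g} -> run t f = run t g.
Proof.
elim: t => //= x t0 IH0 t1 IH1 fg.
rewrite -(fg x) ?mem_head //; case: (f x) fg => fg.
  by apply: IH1 => y yt; apply: fg; rewrite inE yt orbT.
by apply: IH0 => y yt; apply: fg; rewrite inE yt orbT.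
Qed.

(** * Block functions and their distance to k-monotonicity *)

Section HardFunctions.
Local Open Scope nat_scope.
Variables (n M m s : nat).
Hypothesis s_gt0 : 0 < s.
Hypothesis fits : M * m.+2 * s <= n.

(* A group maps to whether it is lit and to the index of its lit block.  The
   index never takes the value m+1, so each group ends with a block of zeros
   that separates lit blocks of different groups. *)
Definition code := {ffun 'I_M -> bool * 'I_m.+1}.
Implicit Types (x : code) (t : dtree n) (f g : 'I_n -> bool) (j : 'I_M).

Definition block (j i : nat) : nat := j * m.+2 + i.

Lemma block_group j i : i < m.+2 -> block j i %/ m.+2 = j.
Proof. by move=> im; rewrite /block divnMDl // divn_small // addn0. Qed.

Lemma block_slot j i : i < m.+2 -> block j i %% m.+2 = i.
Proof. by move=> im; rewrite /block modnMDl modn_small. Qed.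

Definition lit x j : nat := block j (x j).2.

Lemma lit_group x j : lit x j %/ m.+2 = j.
Proof. by rewrite block_group // ltnW // ltnS ltn_ord. Qed.

Lemma lit_slot x j : lit x j %% m.+2 = (x j).2.
Proof. by rewrite block_slot // ltnW // ltnS ltn_ord. Qed.

Definition hard x (p : 'I_n) : bool :=
  [exists j, (x j).1 && (p %/ s == lit x j)].

Definition on x : {set 'I_M} := [set j | (x j).1].

(** The even positions of a forbidden chain give [k./2 + 1] ones. Each lit block is an interval, so
    consecutive ones split by a zero lie in different groups. *)
Lemma hard_kmonotone k x : #|on x| <= k./2 -> kmonotone k (hard x).
Proof.
move=> onk [xs [xs_le xs0 xs_alt]].
pose e i := xs (inord i).
have eS i : i < k -> (e i <= e i.+1) /\ hard x (e i.+1) = ~~ hard x (e i).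
  move=> ik.
  have -> : e i = xs (widen_ord (leqnSn k) (Ordinal ik)).
    by congr xs; apply: val_inj; rewrite /= inordK // ltnW.
  have -> : e i.+1 = xs (lift ord0 (Ordinal ik)).
    by congr xs; apply: val_inj; rewrite /= inordK.
  by split=> //; move: (xs_alt (Ordinal ik)); do 2!case: (hard x _).
have e_le i d : i + d <= k -> e i <= e (i + d).
  elim: d => [|d IH] idk; first by rewrite addn0.
  rewrite addnS in idk *.
  by apply: leq_trans (IH (ltnW idk)) _; case: (eS _ idk).
have e_alt i : i <= k -> hard x (e i) = ~~ odd i.
  elim: i => [_|i IH ik].
    by rewrite -[RHS]xs0; congr (hard x (xs _)); apply: val_inj; rewrite /= inordK.
  by case: (eS _ ik) => _ ->; rewrite IH // ltnW.
have lit_even (i : 'I_(k./2).+1) : exists j, (x j).1 && (e i.*2 %/ s == lit x j).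
  apply/existsP; rewrite -/(hard x (e i.*2)) e_alt ?odd_double //.
  by have := ltn_ord i; lia.
have [h hP] := fin_all_exists lit_even.
have h_lt (a b : 'I_(k./2).+1) : a < b -> h a != h b.
  move=> ab; apply/eqP => hab.
  have /andP[on_a /eqP Ea] := hP a; have /andP[_ /eqP Eb] := hP b.
  have bk := ltn_ord b.
  have ak : a.*2.+1 <= k by lia.
  (* This point lies between two points of one lit block, so its value is 1, while alternation makes
     it 0. *)
  have : hard x (e a.*2.+1).
    apply/existsP; exists (h a); rewrite on_a /= eqn_leq; apply/andP; split.
      rewrite hab -Eb leq_div2r //.
      have -> : b.*2 = a.*2.+1 + (b.*2 - a.*2.+1) by lia.
      by apply: e_le; lia.
    by rewrite -Ea leq_div2r //; case: (eS _ ak).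
  by rewrite e_alt //= odd_double.
have h_inj : injective h.
  move=> a b hab; apply: val_inj; apply/eqP; rewrite eqn_leq.
  by apply/andP; split; rewrite leqNgt; apply/negP => /h_lt; rewrite hab eqxx.
have : #|h @: [set: 'I_(k./2).+1]| <= #|on x|.
  apply/subset_leq_card/subsetP => _ /imsetP[i _ ->].
  by rewrite inE; have /andP[] := hP i.
by rewrite card_imset // cardsT card_ord; lia.
Qed.

Lemma point_proof (j : 'I_M) (i : 'I_m.+2) (u : 'I_s) : block j i * s + u < n.
Proof.
apply: leq_trans fits; rewrite /block.
have := ltn_ord j; have := ltn_ord i; have := ltn_ord u => us im jM.
have : (j * m.+2 + i).+1 * s <= M * m.+2 * s by rewrite leq_mul2r; apply/orP; right; nia.
by rewrite mulSn; lia.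
Qed.

Definition point j i u : 'I_n := Ordinal (point_proof j i u).

Lemma point_block j (i : 'I_m.+2) u : point j i u %/ s = block j i.
Proof. by rewrite /= divnMDl // divn_small // addn0. Qed.

Lemma point_offset j (i : 'I_m.+2) u : point j i u %% s = u.
Proof. by rewrite /= modnMDl modn_small. Qed.

Lemma leq_point j j' (i i' : 'I_m.+2) u : block j i <= block j' i' ->
  point j i u <= point j' i' u.
Proof. by move=> le_b; rewrite /= leq_add2r leq_mul2r le_b orbT. Qed.

Definition lit_point x j u := point j (widen_ord (leqnSn m.+1) (x j).2) u.
Definition gap_point j u := point j ord_max u.

Lemma hard_lit_point x j u : hard x (lit_point x j u) = (x j).1.
Proof.
apply/existsP/idP => [[j']|xj].
  rewrite point_block => /andP[xj' /eqP /(congr1 (divn^~ m.+2))].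
  by rewrite lit_group block_group // => /val_inj ->.
by exists j; rewrite xj point_block /=.
Qed.

Lemma hard_gap_point x j u : hard x (gap_point j u) = false.
Proof.
apply/existsP => -[j' /andP[_]]; rewrite point_block => /eqP.
move=> /(congr1 (modn^~ m.+2)); rewrite lit_slot block_slot //=.
by have := ltn_ord (x j').2; lia.
Qed.

(** In each such group [g] goes from 1 down to 0, so [k] of them in increasing order would supply
    the [k + 1] points of a forbidden chain. *)
Lemma card_agree k x g u : 0 < k -> kmonotone k g ->
  #|[set j in on x | g (lit_point x j u) && ~~ g (gap_point j u)]| < k.
Proof.
move=> k0 gk; set A := [set j in _ | _]; rewrite ltnNge; apply/negP => kA.
apply: gk.
have [j0 _] : exists j, j \in A by apply/card_gt0P; apply: leq_trans kA.
pose js i := nth j0 (enum A) i.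
have jsA i : i < k -> js i \in A.
  by move=> ik; rewrite -mem_enum mem_nth // -cardE (leq_trans ik).
have js_lt i : i.+1 < k -> js i < js i.+1.
  move=> ik.
  have srt : sorted (fun a b : 'I_M => a < b) (enum A).
    rewrite /enum_mem; apply: sorted_filter; first by move=> ? ? ?; apply: ltn_trans.
    by have := iota_ltn_sorted 0 M; rewrite -enumT -val_enum_ord sorted_map.
  have sz : i.+1 < size (enum A) by rewrite -cardE (leq_trans ik).
  exact: (sortedP j0 srt).
pose X i := let j := js i./2 in
  if odd i then gap_point j u else lit_point x j u.
have gX i : i <= k -> g (X i) = ~~ odd i.
  move=> ik; have : js i./2 \in A by apply: jsA; lia.
  by rewrite inE /X => /andP[_ /andP[g1 /negbTE g0]]; case: (odd i).
exists (fun i : 'I_k.+1 => X i); split; rewrite ?gX //.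
  move=> i; have ik := ltn_ord i.
  rewrite lift0 [nat_of_ord (widen_ord _ _)]/= /X oddS -[i.+1./2]/(uphalf i) uphalf_half.
  case io: (odd i); last first.
    rewrite add0n; apply: leq_point; rewrite /block leq_add2l.
    exact: leq_ord.
  apply: leq_point; rewrite /block add1n.
  rewrite [nat_of_ord (widen_ord _ _)]/= [nat_of_ord ord_max]/=.
  have := @js_lt i./2; have -> : i./2.+1 < k by lia.
  move=> /(_ isT) jj; nia.
move=> i; rewrite lift0 [nat_of_ord (widen_ord _ _)]/= !gX //=; last by rewrite ltnW.
by case: (odd i).
Qed.

(** For each offset [u], fewer than [k] of the [2 * k] lit groups escape an error of [g] at the lit
    or the gap point. Different offsets and groups give different points. *)
Lemma hard_far k x g : 0 < k -> 2 * k <= #|on x| -> kmonotone k g ->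
  s * k <= #|[set p | hard x p != g p]|.
Proof.
move=> k0 kon gk.
pose bad (u : 'I_s) := [set j in on x | ~~ (g (lit_point x j u) && ~~ g (gap_point j u))].
have bad_ge u : k <= #|bad u|.
  have := card_agree x u k0 gk; set A := [set j in _ | _] => Ak.
  suff : #|on x| <= #|A| + #|bad u| by lia.
  rewrite -(cardsID A (on x)) leq_add // subset_leq_card //.
    exact: subsetIr.
  by apply/subsetP => j; rewrite !inE => /andP[/[swap] ->].
pose pt (uj : 'I_s * 'I_M) :=
  if g (lit_point x uj.2 uj.1) then gap_point uj.2 uj.1 else lit_point x uj.2 uj.1.
pose B := [set uj : 'I_s * 'I_M | uj.2 \in bad uj.1].
have pt_inj : injective pt.
  move=> [u1 j] [v j'] /(congr1 (@nat_of_ord n)) E.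
  have E1 : u1 = v.
    apply: val_inj; have := congr1 (modn^~ s) E.
    by rewrite /pt; do 2!case: ifP => _; rewrite !point_offset.
  have /val_inj E2 : val j = val j'.
    have := congr1 (fun p => (p %/ s) %/ m.+2) E.
    by rewrite /pt; do 2!case: ifP => _; rewrite !point_block !block_group.
  by rewrite E1 E2.
have cB : s * k <= #|B|.
  rewrite -sum1dep_card -(pair_big_dep xpredT (fun u j => j \in bad u) (fun _ _ => 1)) /=.
  rewrite -[s in s * k]card_ord -sum_nat_const; apply: leq_sum => u _.
  by rewrite sum1_card.
apply: leq_trans cB _; rewrite -(card_imset _ pt_inj) subset_leq_card //.
apply/subsetP => _ /imsetP[[u j] + ->]; rewrite !inE /pt /= => /andP[xj].
case: ifP => /= [_|-> _]; rewrite ?hard_gap_point ?hard_lit_point ?xj //.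
Qed.

(** * Lit blocks seen by a decision tree *)

Definition hits t f : seq nat := [seq nat_of_ord p %/ s | p <- queries t f].

(** The two runs coincide until a first query in block [y], and from then on both memberships
    hold. *)
Lemma mem_hits_agree t f g y :
  (forall p : 'I_n, p %/ s != y -> f p = g p) -> (y \in hits t f) = (y \in hits t g).
Proof.
rewrite /hits => fg; elim: t => //= p t0 IH0 t1 IH1; rewrite !inE.
have [->//|py] := eqVneq y (p %/ s).
by rewrite /= -fg 1?eq_sym //; case: (f p).
Qed.

Definition found t x : {set 'I_M} := [set j in on x | lit x j \in hits t (hard x)].

Lemma reject_found k t x : (forall f, kmonotone k f -> run t f) ->
  ~~ run t (hard x) -> k./2 < #|found t x|.
Proof.
move=> acc; apply: contraNltn => fk.
pose x' : code := [ffun j => (j \in found t x, (x j).2)].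
have litE j : lit x' j = lit x j by rewrite /lit ffunE.
have -> : run t (hard x) = run t (hard x').
  (* A queried point with value 1 lies in a found block, which stays lit in [x']. *)
  apply: eq_run_queries => p pt; apply/existsP/existsP => -[j /andP[xj /eqP Ej]].
    exists j; rewrite litE Ej eqxx andbT ffunE !inE xj /= -Ej.
    by apply/mapP; exists p.
  exists j; rewrite litE in Ej; rewrite Ej eqxx andbT.
  by move: xj; rewrite ffunE !inE /= => /andP[].
apply: acc; apply: hard_kmonotone.
suff -> : on x' = found t x by [].
by apply/setP => j; rewrite inE ffunE.
Qed.

(** * Averaging over all codes *)

Definition update x j (v : bool * 'I_m.+1) : code :=
  [ffun j' => if j' == j then v else x j'].

Lemma hard_toggle x j (b : bool) (p : 'I_n) : p %/ s != lit x j ->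
  hard x p = hard (update x j (b, (x j).2)) p.
Proof.
move=> pj; apply: eq_existsb => j'; rewrite /lit ffunE.
by have [->|//] := eqVneq j' j; rewrite /= -/(lit x j) (negbTE pj) !andbF.
Qed.

Lemma hard_move_off x j i : (x j).1 = false ->
  hard x =1 hard (update x j (false, i)).
Proof.
move=> xj p; apply: eq_existsb => j'; rewrite /lit ffunE.
by have [->|//] := eqVneq j' j; rewrite xj.
Qed.

(** Each query lies in one block, and distinct pairs [(j, i)] number distinct blocks. *)
Lemma sum_hits t x :
  \sum_(j < M) \sum_(i < m.+1) (block j i \in hits t (hard x)) <= depth t.
Proof.
rewrite pair_bigA /=.
rewrite -(big_mkcond
  (fun ji : 'I_M * 'I_m.+1 => block ji.1 ji.2 \in hits t (hard x)) (fun _ => 1)).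
rewrite sum1dep_card.
apply: leq_trans (size_queries t (hard x)).
rewrite -(size_map (fun p : 'I_n => p %/ s)) -/(hits _ _).
set S := [set _ | _].
rewrite cardE -(size_map (fun ji : 'I_M * 'I_m.+1 => block ji.1 ji.2)).
apply: uniq_leq_size => [|_ /mapP[ji + ->]]; last by rewrite mem_enum inE.
rewrite map_inj_uniq ?enum_uniq // => -[j i] [j' i'] /= E.
have lt_i (a : 'I_m.+1) : a < m.+2 by rewrite ltnW // ltnS.
have := congr1 (divn^~ m.+2) E; have := congr1 (modn^~ m.+2) E.
rewrite (block_group _ (lt_i i)) (block_group _ (lt_i i')).
by rewrite (block_slot _ (lt_i i)) (block_slot _ (lt_i i')) => /val_inj -> /val_inj ->.
Qed.

(* Unlighting a found group does not change whether its block is queried. *)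
Lemma sum_found_toggle t j :
  \sum_(x : code) (j \in found t x) =
  \sum_(x : code) (~~ (x j).1 && (lit x j \in hits t (hard x))).
Proof.
pose h x := update x j (~~ (x j).1, (x j).2).
have hK : involutive h.
  move=> x; apply/ffunP => j'; rewrite !ffunE; case: eqP => // ->.
  by rewrite eqxx negbK; case: (x j).
rewrite (reindex_inj (inv_inj hK)) /=; apply: eq_bigr => x _.
rewrite !inE; have -> : lit (h x) j = lit x j by rewrite /lit !ffunE eqxx.
rewrite !ffunE eqxx /=; congr (nat_of_bool (_ && _)).
by apply/esym/mem_hits_agree => p; apply: hard_toggle.
Qed.

(* When group j is off, the run does not depend on its slot, so averaging over
   the slot compares the queried lit block with all queried blocks of the group. *)
Lemma sum_found_slots t j :
  m.+1 * \sum_(x : code) (j \in found t x) <=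
  \sum_(x : code) \sum_(i < m.+1) (block j i \in hits t (hard x)).
Proof.
rewrite sum_found_toggle; set S := \sum_x _.
have -> : m.+1 * S = \sum_(i < m.+1) S by rewrite sum_nat_const card_ord.
rewrite {}/S.
(* Cyclic shift of the slot of group [j] modulo [m.+1], a bijection on codes for each [i]. *)
pose h (i : 'I_m.+1) x := update x j ((x j).1, ((x j).2 + i)%R).
have h_inj i : injective (h i).
  move=> x x' /ffunP E; apply/ffunP => j'; have := E j'; rewrite !ffunE.
  case: eqP => // -> {}E; have /= E1 := congr1 fst E.
  by have /addIr E2 := congr1 snd E; case: (x j) (x' j) E1 E2 => [? ?] [? ?] /= -> ->.
under [leqLHS]eq_bigr => i _ do rewrite (reindex_inj (@h_inj i)) /=.
rewrite exchange_big /=; apply: leq_sum => x _.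
(* The shifted slots run through every slot exactly once. *)
rewrite [leqRHS](reindex_inj (addrI (x j).2)) /=; apply: leq_sum => i _.
rewrite /lit !ffunE eqxx /=; case xj: (x j).1 => //=.
rewrite (@mem_hits_agree t (hard x) (hard (h i x))) // => p _.
by rewrite /h xj; apply: hard_move_off.
Qed.

Lemma sum_found t :
  m.+1 * \sum_(x : code) #|found t x| <= #|{: code}| * depth t.
Proof.
have -> : \sum_(x : code) #|found t x| = \sum_(j < M) \sum_(x : code) (j \in found t x).
  rewrite exchange_big /=; apply: eq_bigr => x _.
  by rewrite -sum1_card big_mkcond.
rewrite big_distrr /=.
apply: leq_trans (leq_sum _ (fun j _ => sum_found_slots t j)) _.
rewrite exchange_big /= -sum_nat_const; apply: leq_sum => x _.
exact: sum_hits.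
Qed.

Lemma sum_reject k t : (forall f, kmonotone k f -> run t f) ->
  k * m.+1 * \sum_(x : code) ~~ run t (hard x) <= 2 * (#|{: code}| * depth t).
Proof.
move=> acc.
have H : k * \sum_(x : code) ~~ run t (hard x) <= 2 * \sum_(x : code) #|found t x|.
  rewrite !big_distrr; apply: leq_sum => x _ /=.
  case E: (run t (hard x)); rewrite ?muln0 // muln1.
  by have := @reject_found k t x acc (negbT E); move: #|found t x| => c; lia.
have := sum_found t; nia.
Qed.

Definition complement x : code := [ffun j => (~~ (x j).1, (x j).2)].

Lemma complementK : involutive complement.
Proof. by move=> x; apply/ffunP => j; rewrite !ffunE negbK; case: (x j). Qed.

Lemma card_on_complement x : #|on x| + #|on (complement x)| = M.
Proof.
have -> : on (complement x) = ~: on x by apply/setP => j; rewrite !inE ffunE.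
by rewrite cardsC card_ord.
Qed.

End HardFunctions.

(** * From decision trees to randomized testers *)

Section TesterBound.
Variables (R : realType) (n k q : nat) (eps : R) (Omega : finType).
Variables (p : Omega -> R) (T : Omega -> dtree n).
Hypothesis tester : one_sided_tester k eps q p T.

Definition rej_prob (f : 'I_n -> bool) : R := \sum_w p w * (~~ run (T w) f)%:R.

Lemma rej_probE f : rej_prob f = 1 - acc_prob p T f.
Proof.
have [[_ p1] _ _ _] := tester.
rewrite -p1 -sumrB; apply: eq_bigr => w _.
by case: (run _ _); rewrite ?mulr1 ?mulr0 ?subrr ?subr0.
Qed.

Lemma rej_prob_ge0 f : 0 <= rej_prob f.
Proof.
have [[p0 _] _ _ _] := tester.
by apply: sumr_ge0 => w _; rewrite mulr_ge0.
Qed.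

(** The rejection probability is a sum of nonnegative terms equal to 0, so every term vanishes. *)
Lemma accept_kmonotone w f : 0 < p w -> kmonotone k f -> run (T w) f.
Proof.
have [[p0 _] _ acc _] := tester.
move=> pw /acc accf; apply/negPn/negP => rejf.
have sum0 : rej_prob f = 0 by rewrite rej_probE accf subrr.
have nneg v : true -> 0 <= p v * (~~ run (T v) f)%:R by rewrite mulr_ge0.
have /(_ w isT) := psumr_eq0P nneg sum0.
by rewrite rejf mulr1 => pw0; rewrite pw0 ltxx in pw.
Qed.

Lemma tester_bound m s : (0 < k)%N -> (0 < s)%N ->
  (4 * k * m.+2 * s <= n)%N -> eps * n%:R <= (s * k)%:R ->
  (k * m.+1 <= 6 * q)%N.
Proof.
move=> k0 s0 fits epsn; have [[p0 p1] depth_q _ rej_far] := tester.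
pose G := code (4 * k) m; pose F (x : G) := hard (n := n) s x.
have n0 : (0 < n)%N by apply: leq_trans fits; rewrite !muln_gt0 k0 s0.
have rej_dense (x : G) : (2 * k <= #|on x|)%N -> 2 / 3 <= rej_prob (F x).
  move=> xk; rewrite rej_probE.
  suff : acc_prob p T (F x) <= 1 / 3 by lra.
  apply: rej_far => g gk; rewrite /dist ler_pdivlMr ?ltr0n //.
  by apply: le_trans epsn _; rewrite ler_nat; apply: (hard_far s0 fits).
have rej_pair (x : G) : 2 / 3 <= rej_prob (F x) + rej_prob (F (complement x)).
  have := card_on_complement x.
  have [xk _|xk cM] := leqP (2 * k) #|on x|.
    by have := rej_dense x xk; have := rej_prob_ge0 (F (complement x)); lra.
  have := rej_dense (complement x); have -> : (2 * k <= #|on (complement x)|)%N by lia.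
  by move=> /(_ isT); have := rej_prob_ge0 (F x); lra.
(* Pairing each code with its complement counts every code twice, so the mean rejection probability
   is at least 1/3. *)
have sum_ge : #|{: G}|%:R * (2 / 3) <= 2 * \sum_(x : G) rej_prob (F x).
  have -> : 2 * \sum_(x : G) rej_prob (F x) =
      \sum_(x : G) (rej_prob (F x) + rej_prob (F (complement x))).
    rewrite big_split mulr2n mulrDl !mul1r; congr (_ + _).
    exact: (reindex_inj (inv_inj (@complementK _ _))).
  by rewrite mulr_natl -sumr_const; apply: ler_sum.
have sum_le : (k * m.+1)%:R * \sum_(x : G) rej_prob (F x) <= (2 * (#|{: G}| * q))%:R.
  set b := leRHS; have -> : b = \sum_w p w * b by rewrite -mulr_suml p1 mul1r.
  rewrite /rej_prob exchange_big /= mulr_sumr.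
  apply: ler_sum => w _; rewrite -mulr_sumr mulrCA.
  (* One-sidedness and the depth bound constrain only seeds of positive weight. *)
  have := p0 w; rewrite le_eqVlt => /orP[/eqP <-|pw]; first by rewrite !mul0r.
  apply: ler_wpM2l (ltW pw) _ _ _.
  rewrite -natr_sum -natrM ler_nat.
  apply: leq_trans (sum_reject s0 fits (fun f => accept_kmonotone (f := f) pw)) _.
  by rewrite !leq_mul2l depth_q ?orbT.
have G0 : (0 < #|{: G}|)%N.
  by apply/card_gt0P; exists [ffun=> (true, ord0)].
have : (#|{: G}| * (k * m.+1))%:R <= (#|{: G}| * (6 * q))%:R :> R.
  rewrite !natrM in sum_le *.
  have : 0 <= k%:R * m.+1%:R :> R by rewrite -natrM.
  nra.
by rewrite ler_nat leq_pmul2l.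
Qed.

End TesterBound.

(** * Choice of the parameters *)

Lemma ratr_invn (R : realType) d : ratr (d%:R^-1) = d%:R^-1 :> R.
Proof. by rewrite fmorphV rmorph_nat. Qed.

Theorem theorem1p3 :
  exists (c eps0 C : rat), [/\ 0 < c, 0 < eps0 &
    forall (R : realType) (n k q : nat) (eps : R) (Omega : finType)
           (p : Omega -> R) (T : Omega -> dtree n),
      0 < eps -> eps <= ratr eps0 -> ratr C * k%:R / eps <= n%:R ->
      @one_sided_tester R n k eps q Omega p T ->
      ratr c * k%:R / eps <= q%:R].
Proof.
(* The bound [eps <= 1/16] makes [y >= 2], and [C = 1] makes all blocks fit. The final chain
   [k / 8 <= 4 k (m + 1) eps <= 24 q eps] gives 192. *)
exists 192^-1, 16^-1, 1; split; [by rewrite invr_gt0 ltr0n..|].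
move=> R n k q eps Omega p T.
rewrite !ratr_invn rmorph1 => eps0 eps_le n_ge tester.
have [->|k0] := posnP k; first by rewrite mulr0 mul0r.
rewrite ler_pdivrMr // in n_ge; rewrite ler_pdivrMr //.
pose y : R := 1 / (8 * eps).
have yE : y * eps = 1 / 8 by rewrite /y; field; rewrite lt0r_neq0.
have y2 : 2 <= y by rewrite /y ler_pdivlMr; lra.
have /andP[ry yr] : (Num.truncn y)%:R <= y < (Num.truncn y).+1%:R.
  by apply: truncn_itv; lra.
case rE: (Num.truncn y) ry yr => [|[|m]] ry yr; [by lra..|].
pose a := (4 * k * m.+2)%N; pose s := (n %/ a)%N.
have a0 : (0 < a)%N by rewrite !muln_gt0 k0.
have reps : m.+2%:R * eps <= 1 / 8 by rewrite -yE ler_pM2r.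
have an : (a <= n)%N.
  rewrite -(ler_nat R) /a !natrM -(ler_pM2r eps0).
  have : k%:R * (m.+2%:R * eps) <= k%:R * (1 / 8) by rewrite ler_wpM2l.
  by have := ler0n R k; nra.
have s0 : (0 < s)%N by rewrite divn_gt0.
(* Rounding the width down loses at most a factor 2, which the 8 in [y] absorbs:
   [eps n <= 8 k s (m + 2) eps <= s k]. *)
have ns : (n <= 2 * (a * s))%N.
  have := ltn_ceil n a0; rewrite -/s mulSn [(s * a)%N]mulnC mul2n -addnn => lt_n.
  by apply/ltnW/(leq_trans lt_n); rewrite leq_add2r leq_pmulr.
have := tester_bound tester k0 s0 (m := m) _ _.
have -> : (4 * k * m.+2 * s <= n)%N by rewrite mulnC leq_trunc_div.
have -> : eps * n%:R <= (s * k)%:R.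
  have : n%:R <= (2 * (a * s))%:R :> R by rewrite ler_nat.
  rewrite /a !natrM => H.
  have : 0 <= k%:R * s%:R :> R by rewrite mulr_ge0.
  nra.
move=> /(_ isT isT); rewrite -(ler_nat R) !natrM => kmq.
(* Truncation gives [y < m + 3], which is below [4 (m + 1)] even for [m = 0]. *)
have y_le : y <= 4 * m.+1%:R by move: yr; rewrite -!natr1; have := ler0n R m; lra.
have k_le : k%:R / 8 <= 4 * (k%:R * m.+1%:R) * eps.
  have : k%:R * (y * eps) <= k%:R * (4 * m.+1%:R * eps) by rewrite ler_wpM2l // ler_pM2r.
  by rewrite yE; lra.
have kq_le : k%:R * m.+1%:R * eps <= 6 * q%:R * eps by rewrite ler_pM2r.
lra.
Qed.
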